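(* Let $k$ be a field of characteristic zero and let $A$ be a connected graded domain over $k$ of finite Gelfand-Kirillov dimension. Assume that $A$ is finitely generated and free as a module over its center. If ${\mathbb D}(A)=A$, then $A$ is cancellative and $\mathrm{Aut}_{uni}(A)=\{1\}$.
   Context: Connected graded means $A=\bigoplus_{i\geq 0}A_i$ with $A_0=k$. Discriminant: if $Z$ is a central subalgebra of $A$ and $A$ is a free $Z$-module of finite rank $r$ with basis $\{z_1,\dots,z_r\}$, let $\mathrm{tr}:A\to Z$ be the trace of left multiplication on $A$ (viewed in $\mathrm{End}(A_Z)\cong M_{r\times r}(Z)$), and put $d(A/Z)=\det(\mathrm{tr}(z_iz_j))_{r\times r}\in Z$, well defined up to an element of $Z^{\times}$. Divisor subalgebra: for a subset $F\subseteq A$, let $Sw(F)$ be the set of $g\in A$ such that $f=agb$ for some $a,b\in A$ and some $0\neq f\in F$. Put $D_0(F)=F$, and for $n\geq 1$ let $D_n(F)$ be the $k$-subalgebra of $A$ generated by $Sw(D_{n-1}(F))$. Let $D(F)=\bigcup_{n\geq 0}D_n(F)$. With $Z$ the center of $A$, ${\mathbb D}(A):=D(\{d(A/Z)\})$ is the discriminant-divisor subalgebra of $A$. $A$ is cancellative if $A[t]\cong B[t]$ for some algebra $B$ implies $A\cong B$. $\mathrm{Aut}_{uni}(A)$ is the group of algebra automorphisms $g$ of $A$ that are unipotent, i.e. $g(v)=v+(\text{higher degree terms})$ for all homogeneous $v\in A$. *)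

(* Defs.v *)
From HB Require Import structures.
From mathcomp Require Import all_boot all_order all_algebra.
From mathcomp Require Import all_classical all_reals all_analysis.

Set Implicit Arguments.
Unset Strict Implicit.
Unset Printing Implicit Defensive.

Import Order.TTheory GRing.Theory Num.Theory.

Local Open Scope classical_set_scope.
Local Open Scope ring_scope.

(* Algebras are associative and unital, not necessarily commutative. *)

(* {poly A} is canonically an A-module. The synonym [polyalg A] carries
   instead the k-algebra structure of A[t], with t central. *)
Definition polyalg (k : fieldType) (A : algType k) : Type := {poly A}.

Section PolyAlg.
Variables (k : fieldType) (A : algType k).

HB.instance Definition _ := GRing.NzRing.on (polyalg A).

Definition polyalg_scale (c : k) (p : polyalg A) : polyalg A :=
  ((c%:A : A) *: (p : {poly A}) : {poly A}).

Fact polyalg_scaleA a b p :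
  polyalg_scale a (polyalg_scale b p) = polyalg_scale (a * b) p.
Proof. by rewrite /polyalg_scale scalerA -scalerAl mul1r scalerA. Qed.

Fact polyalg_scale1 : left_id 1 polyalg_scale.
Proof. by move=> p; rewrite /polyalg_scale !scale1r. Qed.

Fact polyalg_scaleDr : right_distributive polyalg_scale +%R.
Proof. by move=> a p q; rewrite /polyalg_scale scalerDr. Qed.

Fact polyalg_scaleDl p : {morph polyalg_scale^~ p : a b / a + b}.
Proof. by move=> a b; rewrite /polyalg_scale !scalerDl. Qed.

HB.instance Definition _ := GRing.Zmodule_isLmodule.Build k (polyalg A)
  polyalg_scaleA polyalg_scale1 polyalg_scaleDr polyalg_scaleDl.

Fact polyalg_scaleAl (a : k) (p q : polyalg A) :
  polyalg_scale a (p * q) = polyalg_scale a p * q.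
Proof. exact: (@scalerAl A {poly A}). Qed.

HB.instance Definition _ :=
  GRing.Lmodule_isLalgebra.Build k (polyalg A) polyalg_scaleAl.

Fact polyalg_scaleAr (a : k) (p q : polyalg A) :
  polyalg_scale a (p * q) = p * polyalg_scale a q.
Proof.
rewrite /polyalg_scale; apply/polyP => i; rewrite coefZ !coefM mulr_sumr.
apply: eq_bigr => j _; rewrite coefZ.
by rewrite -!scalerAl !mul1r -scalerAr.
Qed.

HB.instance Definition _ :=
  GRing.Lalgebra_isAlgebra.Build k (polyalg A) polyalg_scaleAr.

End PolyAlg.

Definition alg_isomorphic (k : fieldType) (A B : algType k) : Prop :=
  exists f : {lrmorphism A -> B}, bijective f.

Definition cancellative (k : fieldType) (A : algType k) : Prop :=
  forall B : algType k,
    alg_isomorphic (polyalg A) (polyalg B) -> alg_isomorphic A B.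

(* [gr i] is the homogeneous component A_i; the third and fourth clauses say
   that A is the internal direct sum of the A_i. *)
Definition connected_graded (k : fieldType) (A : algType k)
    (gr : nat -> set A) : Prop :=
  [/\ forall i, GRing.submod_closed [in gr i],
      forall i j a b, gr i a -> gr j b -> gr (i + j)%N (a * b),
      forall a, exists n (w : nat -> A),
        (forall i, gr i (w i)) /\ a = \sum_(i < n) w i,
      forall n (w : nat -> A), (forall i, gr i (w i)) ->
        \sum_(i < n) w i = 0 -> forall i, (i < n)%N -> w i = 0
    & gr 0 = range (fun c : k => c%:A)].

(* The submodule \bigoplus_(j > i) A_j. *)
Definition higher (k : fieldType) (A : algType k) (gr : nat -> set A)
    (i : nat) : set A :=
  [set a | exists n (w : nat -> A),
     (forall j, gr j (w j)) /\ a = \sum_(i.+1 <= j < n) w j].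

Definition unipotent (k : fieldType) (A : algType k) (gr : nat -> set A)
    (g : A -> A) : Prop :=
  forall i v, gr i v -> higher gr i (g v - v).

Definition Aut_uni (k : fieldType) (A : algType k) (gr : nat -> set A) :
    set (A -> A) :=
  [set g : A -> A | exists h : {lrmorphism A -> A},
     [/\ bijective h, unipotent gr h & g = (h : A -> A)]].

Section GelfandKirillov.
Variables (k : fieldType) (A : algType k).

Definition span (S : set A) : set A :=
  smallest (fun W : set A => GRing.submod_closed [in W]) S.

Definition is_basis (W : set A) n (v : 'I_n -> A) : Prop :=
  (forall i, W (v i)) /\
  (forall w, W w -> exists! c : 'rV[k]_n, w = \sum_i c 0 i *: v i).

(* Meaningful for finite-dimensional subspaces W only. *)
Definition vdim (W : set A) : nat :=
  xget 0%N [set n | exists v : 'I_n -> A, is_basis W v].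

(* k + V + V^2 + ... + V^n *)
Definition growth (V : set A) (n : nat) : set A :=
  span [set a | exists s : seq A,
    [/\ (size s <= n)%N, forall x, x \in s -> V x & a = \prod_(x <- s) x]].

(* The supremum, over the finite-dimensional subspaces V of A, of
   limsup_n log_n (dim (k + V + ... + V^n)). *)
Definition GKdim (R : realType) : \bar R :=
  ereal_sup [set limn_esup
      (fun n => (ln (vdim (growth V n))%:R / ln n%:R : R)%:E)
    | V in [set V | exists s : seq A, V = span [set` s]]].

End GelfandKirillov.

Section Center.
Variable A : nzRingType.

Definition central : pred A := fun z => `[< forall a, z * a = a * z >].

Fact central_subring : subring_closed central.
Proof.
split.
- by apply/asboolP => a; rewrite mul1r mulr1.
- move=> x y /asboolP hx /asboolP hy; apply/asboolP => a.
  by rewrite mulrBl mulrBr hx hy.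
- move=> x y /asboolP hx /asboolP hy; apply/asboolP => a.
  by rewrite -mulrA hy mulrA hx mulrA.
Qed.

HB.instance Definition _ := GRing.isSubringClosed.Build A central
  central_subring.

Record center_ring := Center { center_val : A; _ : center_val \in central }.

HB.instance Definition _ := [isSub for center_val].
HB.instance Definition _ := [Choice of center_ring by <:].
HB.instance Definition _ := [SubChoice_isSubNzRing of center_ring by <:].

Fact center_mulC : commutative (@GRing.mul center_ring).
Proof.
by move=> x y; apply: val_inj; rewrite !rmorphM /=; exact: (asboolP _ (valP x)).
Qed.

HB.instance Definition _ :=
  GRing.PzRing_hasCommutativeMul.Build center_ring center_mulC.

End Center.

Section Discriminant.
Variables (A : nzRingType) (r : nat) (z : 'I_r -> A).

Definition center_comb (c : 'rV[center_ring A]_r) : A := \sum_i val (c 0 i) * z i.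

Definition center_basis : Prop :=
  forall a, exists! c : 'rV[center_ring A]_r, a = center_comb c.

(* The coordinates of a in z, unspecified unless z is a basis. *)
Definition center_coord (a : A) : 'rV[center_ring A]_r :=
  xget 0 [set c | a = center_comb c].

Definition lmul_mx (a : A) : 'M[center_ring A]_r :=
  \matrix_(i, j) center_coord (a * z i) 0 j.

Definition reg_tr (a : A) : center_ring A := \tr (lmul_mx a).

Definition discriminant : center_ring A := \det (\matrix_(i, j) reg_tr (z i * z j)).

End Discriminant.

Section DivisorSubalgebra.
Variables (k : fieldType) (A : algType k).

Definition subalg_gen (S : set A) : set A :=
  smallest (fun W : set A => GRing.subalg_closed [in W]) S.

Definition Sw (F : set A) : set A :=
  [set g | exists a b f, [/\ F f, f != 0 & f = a * g * b]].

Definition Dn (n : nat) (F : set A) : set A :=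
  iter n (fun D => subalg_gen (Sw D)) F.

Definition divisor_subalg (F : set A) : set A := \bigcup_n Dn n F.

(* Another basis of A over its center changes the discriminant by a central
   unit, which does not affect this subalgebra. *)
Definition discriminant_divisor_subalg r (z : 'I_r -> A) : set A :=
  divisor_subalg [set val (discriminant z)].

End DivisorSubalgebra.

(* Main.v *)
From HB Require Import structures.
Require Import Defs.
From mathcomp Require Import all_boot all_order all_algebra.
From mathcomp Require Import all_classical all_reals all_analysis.

Set Implicit Arguments.
Unset Strict Implicit.
Unset Printing Implicit Defensive.

Import GRing.Theory.

Local Open Scope classical_set_scope.
Local Open Scope ring_scope.

(* Let phi : A[t] -> B[s] be a ring isomorphism, with B a domain. The constant
   terms phi(z_i)(0) form a basis of B over its center, hence of B[s] over its
   center, so phi(d(A/Z)) is the square of a central unit times an element of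
   B; units of B[s] are constant, hence phi(d(A/Z)) lies in B. The set of a in A
   with phi(a) in B is a subalgebra closed under divisors of its nonzero
   elements, so it contains D(A) = A.

   Cancellation: A embeds in B via phi. As phi(t) has positive degree in s, a
   polynomial of positive degree over A is not sent into B, so phi(A) = B.

   Unipotent automorphisms: on A_i put phi(v) = sum_j t^(j-i) (g v)_j, where
   (g v)_j is the component of degree j. This extends to an automorphism of
   A[t], so phi(v) is constant, that is, g(v) = v. *)

(** * Degrees of polynomials over a noncommutative domain *)

Section PolyDomain.
Variables (R : nzRingType) (Rdom : GRing.integral_domain_axiom R).
Implicit Types p q : {poly R}.

Lemma size_mul_domain p q :
  p != 0 -> q != 0 -> size (p * q) = (size p + size q).-1.
Proof.
move=> p0 q0; apply: size_proper_mul; apply/negP => /eqP /Rdom.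
by rewrite !lead_coef_eq0 (negbTE p0) (negbTE q0).
Qed.

Lemma poly_domain : GRing.integral_domain_axiom {poly R}.
Proof.
move=> p q pq0; apply: contraT; rewrite negb_or => /andP[p0 q0].
have := size_mul_domain p0 q0; rewrite pq0 size_poly0.
move: p0 q0; rewrite -!size_poly_gt0.
by case: (size p) => // m; case: (size q) => // n; rewrite addnS.
Qed.

(** Degrees add over a domain, so both factors of a nonzero constant are constant. This serves for
    divisors of constants and for units. *)
Lemma size_mul_le1l p q : p * q != 0 -> (size (p * q)%R <= 1)%N -> (size p <= 1)%N.
Proof.
move=> pq0; have p0 : p != 0 by apply: contraNneq pq0 => ->; rewrite mul0r.
have q0 : q != 0 by apply: contraNneq pq0 => ->; rewrite mulr0.
rewrite size_mul_domain //; move: q0; rewrite -size_poly_gt0.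
by case: (size q) => // n _; rewrite addnS /=; apply: leq_trans; rewrite leq_addr.
Qed.

Lemma size_mul_le1r p q : p * q != 0 -> (size (p * q)%R <= 1)%N -> (size q <= 1)%N.
Proof.
move=> pq0; have p0 : p != 0 by apply: contraNneq pq0 => ->; rewrite mul0r.
have q0 : q != 0 by apply: contraNneq pq0 => ->; rewrite mulr0.
rewrite size_mul_domain //; move: p0; rewrite -size_poly_gt0.
by case: (size p) => // n _; rewrite addSn /=; apply: leq_trans; rewrite leq_addl.
Qed.

End PolyDomain.

(** * Closure properties of constant polynomials *)

Section ConstantPolynomials.
Variable R : nzRingType.
Implicit Types p q : {poly R}.

Lemma size_le1D p q : (size p <= 1)%N -> (size q <= 1)%N -> (size (p + q)%R <= 1)%N.
Proof. by move=> hp hq; apply: leq_trans (size_polyD _ _) _; rewrite geq_max hp. Qed.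

Lemma size_le1M p q : (size p <= 1)%N -> (size q <= 1)%N -> (size (p * q)%R <= 1)%N.
Proof. by move=> /size1_polyC -> /size1_polyC ->; rewrite -polyCM size_polyC_leq1. Qed.

Lemma size_det_le1 (C : comNzRingType) (f : {rmorphism C -> {poly R}}) n
    (M : 'M[C]_n) :
  (forall i j, (size (f (M i j)) <= 1)%N) -> (size (f (\det M)) <= 1)%N.
Proof.
move=> hM; rewrite /determinant rmorph_sum.
elim/big_ind: _ => [|p q|s _]; [by rewrite size_poly0|exact: size_le1D|].
rewrite rmorphM rmorph_sign; apply: size_le1M.
  by rewrite -signr_odd; case: odd; rewrite ?expr1 ?size_polyN ?expr0 size_poly1.
rewrite rmorph_prod; elim/big_ind: _ => [|p q|i _]; last exact: hM.
  by rewrite size_poly1.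
exact: size_le1M.
Qed.

End ConstantPolynomials.

(** * The trace form under a change of basis with central coefficients *)

Section ChangeOfBasis.
Variables (C : comNzRingType) (R : nzRingType) (f : {rmorphism C -> R}) (r : nat).
Hypothesis f_central : forall c a, f c * a = a * f c.

(** Row [i] of [l a] holds the coordinates of [a * y_i]: the transpose of the usual matrix of left
    multiplication, with the same trace. *)
Definition is_lmul (y : 'cV[R]_r) (l : R -> 'M[C]_r) :=
  forall a, a *: y = map_mx f (l a) *m y.

(** Each row of [M] is one relation; taking [r] of them at once allows square matrices to be
    cancelled in front of [y]. *)
Definition lin_indep (y : 'cV[R]_r) :=
  forall M : 'M[C]_r, map_mx f M *m y = 0 -> M = 0.

Lemma scale_mulmx_central (M : 'M[C]_r) (a : R) (y : 'cV[R]_r) :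
  a *: (map_mx f M *m y) = map_mx f M *m (a *: y).
Proof.
apply/matrixP => i j; rewrite !mxE mulr_sumr; apply: eq_bigr => l _.
by rewrite !mxE !mulrA f_central.
Qed.

Lemma lin_indep_inj y (M N : 'M[C]_r) :
  lin_indep y -> map_mx f M *m y = map_mx f N *m y -> M = N.
Proof.
move=> yind /eqP; rewrite -subr_eq0 -mulmxBl -map_mxB => /eqP /yind /eqP.
by rewrite subr_eq0 => /eqP.
Qed.

Variables (y w : 'cV[R]_r) (P Q : 'M[C]_r) (ly lw : R -> 'M[C]_r).
Hypotheses (yind : lin_indep y) (lyP : is_lmul y ly) (lwP : is_lmul w lw).
Hypotheses (wE : w = map_mx f P *m y) (yE : y = map_mx f Q *m w).

Lemma change_basis_mulV : Q *m P = 1%:M.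
Proof.
apply: (lin_indep_inj yind).
by rewrite map_mxM -mulmxA -wE -yE map_mx1 mul1mx.
Qed.

Lemma change_basis_ind : lin_indep w.
Proof.
move=> M; rewrite wE mulmxA -map_mxM => /yind MP0.
by rewrite -[M]mulmx1 -(mulmx1C change_basis_mulV) mulmxA MP0 mul0mx.
Qed.

(** The two matrices of left multiplication are conjugate by [P], whose inverse is [Q]. *)
Lemma tr_change_basis a : \tr (lw a) = \tr (ly a).
Proof.
have -> : lw a = P *m ly a *m Q.
  apply: (lin_indep_inj change_basis_ind).
  rewrite -lwP !map_mxM -!mulmxA -yE -lyP {1}wE.
  exact: scale_mulmx_central.
by rewrite mxtrace_mulC mulmxA change_basis_mulV mul1mx.
Qed.

Lemma tr_lmul_sum (I : finType) (c : I -> C) (a : I -> R) :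
  \tr (ly (\sum_i f (c i) * a i)) = \sum_i c i * \tr (ly (a i)).
Proof.
have -> : ly (\sum_i f (c i) * a i) = \sum_i c i *: ly (a i).
  apply: (lin_indep_inj yind); rewrite -lyP scaler_suml map_mx_sum mulmx_suml.
  by apply: eq_bigr => i _; rewrite map_mxZ -scalemxAl -lyP scalerA.
by rewrite raddf_sum; apply: eq_bigr => i _; rewrite /= mxtraceZ.
Qed.

(** The trace form is bilinear over [C], so its Gram matrix [G] for [y] becomes [P G P^T] for
    [w]. *)
Lemma det_tr_change_basis :
  \det (\matrix_(i, j) \tr (lw (w i 0 * w j 0))) =
  \det P * \det (\matrix_(i, j) \tr (ly (y i 0 * y j 0))) * \det P.
Proof.
rewrite -{2}[P]trmxK det_tr -!det_mulmx; congr (\det _).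
apply/matrixP => i j; rewrite !mxE tr_change_basis.
have -> : w i 0 * w j 0 =
    \sum_(kl : 'I_r * 'I_r) f (P i kl.1 * P j kl.2) * (y kl.1 0 * y kl.2 0).
  rewrite {1 2}wE !mxE big_distrlr pair_big /=; apply: eq_bigr => -[k l] _ /=.
  by rewrite !mxE rmorphM -!mulrA; congr (_ * _); rewrite !mulrA f_central.
rewrite tr_lmul_sum -(pair_big xpredT xpredT (fun k l =>
  P i k * P j l * \tr (ly (y k 0 * y l 0)))) /= exchange_big /=.
apply: eq_bigr => l _; rewrite !mxE mulr_suml; apply: eq_bigr => k _.
by rewrite !mxE mulrAC.
Qed.

End ChangeOfBasis.

(** * The center of A[t] and bases over it *)

Section CenterOfPolynomials.
Variable A : nzRingType.

Lemma center_valC (c : center_ring A) (a : A) : val c * a = a * val c.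
Proof. exact: (asboolP _ (valP c)). Qed.

Lemma central_val (a : A) :
  (forall b, a * b = b * a) -> exists c : center_ring A, val c = a.
Proof. by move=> /asboolP ac; exists (Center ac). Qed.

Lemma map_val_central (c : {poly center_ring A}) (p : {poly A}) :
  map_poly val c * p = p * map_poly val c.
Proof.
apply/polyP => n; rewrite coefM coefMr; apply: eq_bigr => i _.
by rewrite coef_map center_valC.
Qed.

(** Commuting with the constants alone already makes every coefficient central. *)
Lemma central_polyP (p : {poly A}) :
  (forall q, p * q = q * p) -> exists c : {poly center_ring A}, map_poly val c = p.
Proof.
move=> pC; have /choice[c cE] n : exists c : center_ring A, val c = p`_n.
  apply: central_val => a.
  by have := congr1 (fun q : {poly A} => q`_n) (pC a%:P); rewrite coefMC coefCM.
exists (\poly_(n < size p) c n); apply/polyP => n.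
rewrite coef_map coef_poly; case: ltnP => [_|/(nth_default 0) ->].
  exact: cE.
by rewrite raddf0.
Qed.

Variables (r : nat) (z : 'I_r -> A).
Hypothesis zbasis : center_basis z.

Lemma center_coordP a : a = center_comb z (center_coord z a).
Proof.
have [c [ac _]] := zbasis a.
by apply: (@xgetPex _ 0 [set d | a = center_comb z d]); exists c.
Qed.

Lemma center_comb_eq0 c : center_comb z c = 0 -> c = 0.
Proof.
move=> c0; have [c' [_ c'U]] := zbasis 0.
rewrite -(c'U c) //; apply: c'U; rewrite /center_comb big1 // => i _.
by rewrite mxE rmorph0 mul0r.
Qed.

Lemma poly_center_span (p : {poly A}) :
  exists c : 'I_r -> {poly center_ring A},
    p = \sum_i map_poly val (c i) * (z i)%:P.
Proof.
exists (fun i => \poly_(n < size p) center_coord z p`_n 0 i).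
apply/polyP => n; rewrite coef_sum.
under eq_bigr do rewrite coefMC coef_map coef_poly.
case: ltnP => [_|/(nth_default 0) ->]; first exact: center_coordP.
by rewrite big1 // => i _; rewrite raddf0 mul0r.
Qed.

Lemma poly_center_free (c : 'I_r -> {poly center_ring A}) :
  \sum_i map_poly val (c i) * (z i)%:P = 0 -> forall i, c i = 0.
Proof.
move=> c0 i; apply/polyP => n.
have /center_comb_eq0/rowP/(_ i) : center_comb z (\row_i (c i)`_n) = 0.
  have := congr1 (fun q : {poly A} => q`_n) c0; rewrite coef_sum coef0 => <-.
  by apply: eq_bigr => j _; rewrite coefMC coef_map mxE.
by rewrite !mxE coef0.
Qed.

End CenterOfPolynomials.

(** * The image of the discriminant under an isomorphism from A[t] to B[s] *)

Section DiscriminantUnderIsomorphism.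
Variables (A B : nzRingType) (phi : {rmorphism {poly A} -> {poly B}}).
Hypothesis phi_bij : bijective phi.
Variables (r : nat) (z : 'I_r -> A).
Hypothesis zbasis : center_basis z.

(** With Z the center of A, [C] is Z[t], the center of A[t], and [f] carries it onto the center of
    B[s]. *)
Let C : comNzRingType := {poly center_ring A}.
Let f : {rmorphism C -> {poly B}} := phi \o map_poly val.

Let fE c : f c = phi (map_poly val c). Proof. by []. Qed.

Let f_central c b : f c * b = b * f c.
Proof.
have [psi _ psiK] := phi_bij.
by rewrite fE -(psiK b) -!rmorphM map_val_central.
Qed.

Let central_image (b : {poly B}) :
  (forall q, b * q = q * b) -> exists c, f c = b.
Proof.
have [psi phiK psiK] := phi_bij; move=> bC.
have [q|c cE] := @central_polyP A (psi b); last by exists c; rewrite /= cE psiK.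
by apply: (can_inj phiK); rewrite !rmorphM psiK bC.
Qed.

Let y : 'cV[{poly B}]_r := \col_i phi (z i)%:P.
Let w : 'cV[{poly B}]_r := \col_i ((phi (z i)%:P)`_0)%:P.

Let y_span (b : {poly B}) : exists c : 'I_r -> C, b = \sum_i f (c i) * y i 0.
Proof.
have [psi _ psiK] := phi_bij; have [c psibE] := poly_center_span zbasis (psi b).
exists c; rewrite -[b]psiK psibE rmorph_sum; apply: eq_bigr => i _.
by rewrite rmorphM mxE.
Qed.

Let y_free : lin_indep f y.
Proof.
move=> M My0; apply/matrixP => i j; rewrite mxE; move: j.
apply: (poly_center_free zbasis); apply: (bij_inj phi_bij).
have /matrixP/(_ i 0) := My0; rewrite !mxE rmorph0 => <-.
rewrite rmorph_sum; apply: eq_bigr => j _.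
by rewrite rmorphM !mxE.
Qed.

(** Setting s = 0 in the expansion of [b] along [y] turns [y] into [w]. The constant term of a
    central polynomial is again central, so the new coefficients come from [C]. *)
Let w_span_const (b : B) : exists c : 'I_r -> C,
  b%:P = \sum_i f (c i) * w i 0 /\ forall i, (size (f (c i)) <= 1)%N.
Proof.
have [c bE] := y_span b%:P.
have /choice[c' c'E] i : exists c', f c' = ((f (c i))`_0)%:P.
  have c0C a : (f (c i))`_0 * a = a * (f (c i))`_0.
    have := congr1 (fun q : {poly B} => q`_0) (f_central (c i) a%:P).
    by rewrite coefMC coefCM.
  apply: central_image => q; apply/polyP => n.
  by rewrite coefCM coefMC.
exists c'; split=> [|i]; last by rewrite c'E size_polyC_leq1.
have := congr1 (fun q : {poly B} => q`_0) bE; rewrite coefC eqxx coef_sum => ->.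
rewrite rmorph_sum; apply: eq_bigr => i _.
by rewrite !mxE coef0M rmorphM c'E.
Qed.

Let w_span (b : {poly B}) : exists c : 'I_r -> C,
  b = \sum_i f (c i) * w i 0 /\
  ((size b <= 1)%N -> forall i, (size (f (c i)) <= 1)%N).
Proof.
(* Constants are treated apart so that their chosen coordinates are constant too; other polynomials
   are expanded coefficient by coefficient, with [g] the preimage of s. *)
have [/size1_polyC -> |b_gt1] := leqP (size b) 1.
  by have [c [cE csize]] := w_span_const b`_0; exists c.
have /choice[c cE] n : exists c : 'I_r -> C, (b`_n)%:P = \sum_i f (c i) * w i 0.
  by have [c []] := w_span_const b`_n; exists c.
have [g gE] : exists g, f g = 'X.
  by apply: central_image => q; rewrite commr_polyX.
exists (fun i => \sum_(n < size b) c n i * g ^+ n); split=> //.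
rewrite -[LHS]coefK poly_def.
under [RHS]eq_bigr do rewrite rmorph_sum mulr_suml.
rewrite exchange_big; apply: eq_bigr => n _.
rewrite -mul_polyC cE mulr_suml; apply: eq_bigr => i _.
by rewrite rmorphM rmorphXn gE -!mulrA commr_polyXn.
Qed.

Lemma size_phi_discriminant : GRing.integral_domain_axiom B ->
  (size (phi (val (discriminant z))%:P) <= 1)%N.
Proof.
move=> Bdom; have [/choice[cy cyE] /choice[cw cwE]] := (y_span, w_span).
pose P : 'M[C]_r := \matrix_(i, j) cy (w i 0) j.
pose Q : 'M[C]_r := \matrix_(i, j) cw (y i 0) j.
pose ly a : 'M[C]_r := \matrix_(i, j) cy (a * y i 0) j.
pose lw a : 'M[C]_r := \matrix_(i, j) cw (a * w i 0) j.
have lyP : is_lmul f y ly.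
  move=> a; apply/matrixP => i j; rewrite ord1 mxE [LHS]cyE [RHS]mxE.
  by apply: eq_bigr => l _; rewrite !mxE.
have lwP : is_lmul f w lw.
  move=> a; apply/matrixP => i j; rewrite ord1 mxE [LHS](proj1 (cwE _)) [RHS]mxE.
  by apply: eq_bigr => l _; rewrite !mxE.
have wE : w = map_mx f P *m y.
  apply/matrixP => i j; rewrite ord1 [LHS]cyE [RHS]mxE.
  by apply: eq_bigr => l _; rewrite !mxE.
have yE : y = map_mx f Q *m w.
  apply/matrixP => i j; rewrite ord1 [LHS](proj1 (cwE _)) [RHS]mxE.
  by apply: eq_bigr => l _; rewrite !mxE.
have w_free := change_basis_ind y_free wE yE.
(* The discriminant is transported to the basis [y]; independence of [y] identifies the chosen
   coordinates [ly] with the images of [center_coord]. *)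
have discE : f (\det (\matrix_(i, j) \tr (ly (y i 0 * y j 0)))) =
    phi (val (discriminant z))%:P.
  rewrite /= -[RHS]/(phi (val (discriminant z))%:P) -map_polyC /discriminant.
  rewrite -det_map_mx; congr (phi (map_poly _ (\det _))).
  apply/matrixP => i j; rewrite !mxE -trace_map_mx; congr (\tr _).
  apply: (lin_indep_inj y_free); rewrite -lyP; apply/matrixP => l m.
  rewrite ord1 !mxE -!rmorphM [z i * z j * z l](center_coordP zbasis).
  rewrite !rmorph_sum; apply: eq_bigr => n _.
  by rewrite !mxE fE map_polyC !rmorphM.
(* The roles of [y] and [w] are exchanged, so the outer factors are [\det Q]. *)
rewrite -discE (det_tr_change_basis f_central w_free lwP lyP yE wE) !rmorphM.
(* [\det Q] is a unit, with inverse [\det P], and units over a domain are constant. *)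
have Qsize : (size (f (\det Q)) <= 1)%N.
  have QP1 : f (\det Q) * f (\det P) = 1.
    by rewrite -rmorphM -det_mulmx (change_basis_mulV y_free wE yE) det1 rmorph1.
  by apply: (size_mul_le1l Bdom (q := f (\det P))); rewrite QP1 ?oner_neq0 ?size_poly1.
apply: size_le1M => //; apply: size_le1M => //; apply: size_det_le1 => i j.
rewrite mxE rmorph_sum; elim/big_ind: _ => [|p q|l _].
- by rewrite size_poly0.
- exact: size_le1D.
(* The diagonal entries of [lw (w_i * w_j)] are coordinates of products of three constants, hence
   constant by the choice of [cw]. *)
rewrite mxE; apply: (proj2 (cwE _)).
by rewrite !mxE -!polyCM size_polyC_leq1.
Qed.

End DiscriminantUnderIsomorphism.

(** * Elements with constant image and the divisor subalgebra *)

Section DivisorSubalgebraUnderIsomorphism.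
Variables (k : fieldType) (A B : algType k).
Variable phi : {rmorphism {poly A} -> {poly B}}.
Hypotheses (Bdom : GRing.integral_domain_axiom B) (phi_inj : injective phi).

Let constant_image : set A := [set a | (size (phi a%:P) <= 1)%N].

(** [phi] is only a ring morphism, so scalars need an argument: a nonzero one is a unit, and so is
    its image. *)
Let constant_image_scalar (c : k) : constant_image c%:A.
Proof.
rewrite /constant_image /=; have [->|c0] := eqVneq c 0.
  by rewrite scale0r !rmorph0 size_poly0.
apply: (size_mul_le1l Bdom (q := phi (c^-1%:A)%:P));
  by rewrite -!rmorphM /= mulr_algl scalerA divff // scale1r !rmorph1
     ?oner_neq0 ?size_poly1.
Qed.

Lemma constant_image_subalg : GRing.subalg_closed [in constant_image].
Proof.
have M a b : constant_image a -> constant_image b -> constant_image (a * b).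
  by rewrite /constant_image /= !rmorphM; apply: size_le1M.
split=> [|c a b|a b]; rewrite !inE.
- by rewrite -(scale1r 1); apply: constant_image_scalar.
- move=> ha hb; rewrite -mulr_algl /constant_image /= !rmorphD.
  by apply: size_le1D => //; apply: M.
- exact: M.
Qed.

Lemma constant_image_Sw F : F `<=` constant_image -> Sw F `<=` constant_image.
Proof.
move=> FW h [a [b [x [/FW]]]]; rewrite /constant_image /= => xle x0 xE.
have px0 : phi x%:P != 0.
  by rewrite raddf_eq0 // polyC_eq0.
move: xle px0; rewrite xE !rmorphM => xle px0.
(* From the image of [a * h * b], first the right factor [b] is removed, then the left factor
   [a]. *)
apply: (size_mul_le1r Bdom) (size_mul_le1l Bdom px0 xle).
by apply: contraNneq px0 => ->; rewrite mul0r.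
Qed.

Lemma constant_image_divisor_subalg F :
  F `<=` constant_image -> divisor_subalg F `<=` constant_image.
Proof.
move=> FW a [n _]; elim: n a => //= n IHn a.
apply: smallest_sub; first exact: constant_image_subalg.
exact: constant_image_Sw.
Qed.

End DivisorSubalgebraUnderIsomorphism.

(** * Degree growth and cancellation *)

Section ConstantsToConstants.
Variables (A B : nzRingType) (phi : {rmorphism {poly A} -> {poly B}}).
Hypotheses (Bdom : GRing.integral_domain_axiom B) (phi_bij : bijective phi).
Hypothesis phi_const : forall a, (size (phi a%:P) <= 1)%N.

(** Otherwise every image would be constant, against surjectivity. *)
Lemma size_phiX : (1 < size (phi 'X))%N.
Proof.
rewrite ltnNge; apply/negP => Xle; have [psi _ psiK] := phi_bij.
have le1 (p : {poly A}) : (size (phi p) <= 1)%N.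
  elim/poly_ind: p => [|p a IHp]; first by rewrite rmorph0 size_poly0.
  by rewrite rmorphD rmorphM; apply: size_le1D => //; apply: size_le1M.
by have := le1 (psi 'X); rewrite psiK size_polyX.
Qed.

(** Horner induction: multiplying by the image of t raises the degree by at least one, and the
    constant [phi a%:P] cannot cancel the leading term. *)
Lemma size_le_phi (p : {poly A}) : (size p <= size (phi p))%N.
Proof.
elim/poly_ind: p => [|p a IHp]; first by rewrite size_poly0.
have [->|p0] := eqVneq p 0.
  rewrite mul0r add0r size_polyC; case: eqP => // /eqP a0.
  by rewrite size_poly_gt0 raddf_eq0 ?polyC_eq0 //; apply: bij_inj.
have pp0 : phi p != 0.
  by rewrite -size_poly_gt0; apply: leq_trans IHp; rewrite size_poly_gt0.
have szM : (size p < size (phi p * phi 'X)%R)%N.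
  have X0 : phi 'X != 0 by rewrite -size_poly_gt0; exact: ltnW size_phiX.
  rewrite size_mul_domain //; move: size_phiX.
  case: (size (phi 'X)) => [|[|n]] // _.
  by rewrite !addnS ltnS; apply: leq_trans IHp _; apply: leq_addr.
rewrite size_MXaddC (negbTE p0) rmorphD rmorphM size_polyDl //.
apply: leq_ltn_trans (phi_const a) _; apply: leq_ltn_trans szM.
by rewrite size_poly_gt0.
Qed.

End ConstantsToConstants.

Lemma polyalg_scaleC (k : fieldType) (A : algType k) (c : k) (a : A) :
  polyalg_scale c a%:P = (c *: a)%:P.
Proof. by rewrite /polyalg_scale -mul_polyC -polyCM mulr_algl. Qed.

Lemma cancellative_of_constant_images (k : fieldType) (A : algType k) :
  GRing.integral_domain_axiom A ->
  (forall (B : algType k) (phi : {rmorphism {poly A} -> {poly B}}),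
     GRing.integral_domain_axiom B -> bijective phi ->
     forall a, (size (phi a%:P) <= 1)%N) ->
  cancellative A.
Proof.
move=> Adom const B [phi phi_bij].
(* [phi0] forgets the [k]-structure; [phi] itself is kept for the linearity of [f]. *)
pose phi0 : {rmorphism {poly A} -> {poly B}} := phi.
have [psi phiK psiK] : bijective phi0 := phi_bij.
(* B embeds through [psi] in A[t], which is a domain. *)
have Bdom : GRing.integral_domain_axiom B.
  move=> a b ab0; have /poly_domain : psi a%:P * psi b%:P = 0.
    by apply: (can_inj phiK); rewrite rmorphM !psiK -polyCM ab0 rmorph0.
  move=> /(_ Adom) /orP[] /eqP ps0; apply/orP; [left|right];
    by rewrite -polyC_eq0 -[_%:P]psiK ps0 rmorph0.
have phi0_const := const B phi0 Bdom phi_bij.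
pose f a : B := (phi0 a%:P)`_0.
have fE a : (f a)%:P = phi0 a%:P by rewrite -size1_polyC.
have f_lin : linear f.
  move=> c a b; apply: polyC_inj; rewrite fE.
  rewrite !polyCD rmorphD -!polyalg_scaleC !fE; congr (_ + _).
  exact: (linearZZ phi c (a%:P : polyalg A)).
have f_mul : monoid_morphism f.
  split=> [|a b]; apply: polyC_inj; rewrite ?polyCM !fE ?rmorph1 //.
  by rewrite !rmorphM.
pose f1 := GRing.isLinear.Build _ _ _ _ f f_lin.
pose f2 := GRing.isMonoidMorphism.Build _ _ f f_mul.
pose g : {lrmorphism A -> B} := HB.pack f f1 f2.
exists g.
exists (fun b => (psi b%:P)`_0) => [a|b].
  by rewrite /= fE phiK coefC.
(* As [phi0] does not lower degrees, the preimage of a constant is constant; this gives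
   surjectivity. *)
have : (size (psi b%:P) <= 1)%N.
  have := @size_le_phi A B phi0 Bdom phi_bij phi0_const (psi b%:P).
  by rewrite psiK => /leq_trans; apply; apply: size_polyC_leq1.
move=> /size1_polyC pE; apply: polyC_inj; rewrite /= fE -pE; exact: psiK.
Qed.

Lemma extend_to_polyX (A : nzRingType) (h : {rmorphism A -> {poly A}}) :
  exists E : {rmorphism {poly A} -> {poly A}},
    (forall a, E a%:P = h a) /\ E 'X = 'X.
Proof.
have hX : commr_rmorph h 'X by move=> a; rewrite /GRing.comm commr_polyX.
exists (horner_morph hX); split=> [a|].
  exact: horner_morphC.
exact: horner_morphX.
Qed.

(** * Recording the grading of A by powers of t *)

Section Graded.
Variables (k : fieldType) (A : algType k) (gr : nat -> set A).
Hypothesis Agraded : connected_graded gr.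

Lemma graded0 i : gr i 0.
Proof. by have [/(_ i)[+ _] _ _ _ _] := Agraded; rewrite inE. Qed.

Lemma gradedP i (c : k) a b : gr i a -> gr i b -> gr i (c *: a + b).
Proof.
have [/(_ i)[_ h] _ _ _ _] := Agraded => ia ib.
by have := h c a b; rewrite !inE; apply.
Qed.

Lemma gradedD i a b : gr i a -> gr i b -> gr i (a + b).
Proof. by move=> ia ib; rewrite -[a]scale1r; apply: gradedP. Qed.

Lemma gradedB i a b : gr i a -> gr i b -> gr i (a - b).
Proof. by move=> ia ib; rewrite addrC -scaleN1r; apply: gradedP. Qed.

Definition homogeneous_coefs (q : {poly A}) := forall i, gr i q`_i.

Lemma homogeneous_coefsM p q :
  homogeneous_coefs p -> homogeneous_coefs q -> homogeneous_coefs (p * q).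
Proof.
have [_ grM _ _ _] := Agraded => hp hq i; rewrite coefM.
elim/big_ind: _ => [|a b|j _]; [exact: graded0|exact: gradedD|].
by have := grM _ _ _ _ (hp j) (hq (i - j)%N); rewrite subnKC // -ltnS.
Qed.

Lemma homogeneous_coefsZXn i v : gr i v -> homogeneous_coefs (v%:P * 'X^i).
Proof.
move=> iv j; rewrite coefCM coefXn; case: eqP => [->|_].
  by rewrite mulr1.
by rewrite mulr0; apply: graded0.
Qed.

(** Evaluation at 1 adds up elements of distinct degrees, and the sum of the A_i is direct. *)
Lemma homogeneous_coefs_eq0 q : homogeneous_coefs q -> q.[1] = 0 -> q = 0.
Proof.
have [_ _ _ direct _] := Agraded => hq q1.
apply/polyP => i; rewrite coef0.
have [/(nth_default 0)//|ilt] := leqP (size q) i.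
apply: (direct (size q)) ilt => //.
by rewrite -[RHS]q1 horner_coef; apply: eq_bigr => j _; rewrite expr1n mulr1.
Qed.

(* [e] identifies A with the subring of A[t] consisting of the polynomials
   whose coefficient of t^i lies in A_i; its inverse is evaluation at 1. *)
Lemma rees_embedding : exists e : {rmorphism A -> {poly A}},
  forall a, homogeneous_coefs (e a) /\ (e a).[1] = a.
Proof.
have [_ _ decomp _ gr0] := Agraded.
have /choice[e eP] a : exists q, homogeneous_coefs q /\ q.[1] = a.
  have [n [w [wgr ->]]] := decomp a; exists (\poly_(i < n) w i); split=> [i|].
    by rewrite coef_poly; case: ifP => _ //; apply: graded0.
  by rewrite horner_poly; apply: eq_bigr => i _; rewrite expr1n mulr1.
(* A polynomial with homogeneous coefficients is determined by its value at 1, so each morphism law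
   reduces to exhibiting such a polynomial. *)
have e_uniq q : homogeneous_coefs q -> e q.[1] = q.
  move=> hq; apply/eqP; rewrite -subr_eq0; apply/eqP/homogeneous_coefs_eq0.
    by move=> i; rewrite coefB; apply: gradedB; [apply: (proj1 (eP _))|].
  by rewrite hornerD hornerN (proj2 (eP _)) subrr.
have e_zmod : zmod_morphism e.
  move=> a b; rewrite -{1}(proj2 (eP a)) -{1}(proj2 (eP b)) -hornerN -hornerD.
  by apply: e_uniq => i; rewrite coefB; apply: gradedB; apply: (proj1 (eP _)).
have e_monoid : monoid_morphism e.
  split=> [|a b].
    rewrite -{1}(hornerC 1 1); apply: e_uniq => i; rewrite coefC.
    case: eqP => [->|_]; last exact: graded0.
    by rewrite gr0; exists 1 => //; rewrite scale1r.
  rewrite -{1}(proj2 (eP a)) -{1}(proj2 (eP b)) -hornerM_comm.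
    by apply: e_uniq; apply: homogeneous_coefsM; apply: (proj1 (eP _)).
  by rewrite /comm_poly mulr1 mul1r.
pose e1 := GRing.isZmodMorphism.Build _ _ e e_zmod.
pose e2 := GRing.isMonoidMorphism.Build _ _ e e_monoid.
pose e' : {rmorphism A -> {poly A}} := HB.pack e e1 e2.
by exists e'.
Qed.

(** * Homogenizing a unipotent automorphism *)

Section Rees.
Variables (e : {rmorphism A -> {poly A}}) (E : {rmorphism {poly A} -> {poly A}}).
Hypotheses (e_hom : forall a, homogeneous_coefs (e a)).
Hypotheses (e_eval : forall a, (e a).[1] = a).
Hypotheses (EC : forall a, E a%:P = e a) (EX : E 'X = 'X).

Lemma rees_eval q : homogeneous_coefs q -> e q.[1] = q.
Proof.
move=> hq; apply/eqP; rewrite -subr_eq0; apply/eqP/homogeneous_coefs_eq0.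
  by move=> i; rewrite coefB; apply: gradedB; [apply: e_hom|].
by rewrite hornerD hornerN e_eval subrr.
Qed.

Lemma rees_homogeneous i v : gr i v -> e v = 'X^i * v%:P.
Proof.
move=> /homogeneous_coefsZXn /rees_eval.
by rewrite mul_polyC hornerZ hornerXn expr1n mulr1 -mul_polyC commr_polyXn.
Qed.

Lemma sum_homogeneous a : a = \sum_(i < size (e a)) (e a)`_i.
Proof.
rewrite -[LHS]e_eval horner_coef.
by apply: eq_bigr => i _; rewrite expr1n mulr1.
Qed.

(** [E] sends v t^n, with v in A_i, to v t^(n+i); all contributions to t^m are collected here. *)
Lemma coef_E p m : (E p)`_m = \sum_(i < m.+1) (e p`_(m - i))`_i.
Proof.
elim/poly_ind: p m => [|p a IHp] m.
  by rewrite rmorph0 coef0 big1 // => i _; rewrite coef0 rmorph0 coef0.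
rewrite rmorphD rmorphM EX EC coefD coefMX; case: m => [|m].
  by rewrite big_ord1 coefD coefMX coefC add0r add0r.
rewrite IHp [RHS]big_ord_recr /= subnn coefD coefMX coefC !add0r; congr (_ + _).
apply: eq_bigr => i _.
have im : (i <= m)%N by rewrite -ltnS.
by rewrite (subSn im) coefD coefMX coefC addr0.
Qed.

Lemma E_inj : injective E.
Proof.
apply: raddf_inj => p Ep0; apply/polyP => n; rewrite coef0.
have [_ _ _ direct _] := Agraded.
rewrite (sum_homogeneous p`_n) big1 // => i _.
have := direct (n + i).+1 (fun j => (e p`_(n + i - j))`_j).
move=> /(_ _ _ i); rewrite addnK; apply.
- by move=> j; apply: e_hom.
- by rewrite -coef_E Ep0 coef0.
- by rewrite ltnS leq_addl.
Qed.

Lemma EXn n : E 'X^n = 'X^n.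
Proof. by rewrite rmorphXn EX. Qed.

Lemma mulXnI n (p q : {poly A}) : 'X^n * p = 'X^n * q -> p = q.
Proof. exact: (monic_lreg (monicXn A n)). Qed.

Lemma map_poly_mulXn (g : {rmorphism A -> A}) n (u : {poly A}) :
  map_poly g ('X^n * u) = 'X^n * map_poly g u.
Proof. by rewrite rmorphM; congr (_ * _); apply: map_polyXn. Qed.

(* In A[t, 1/t] this says that q = E (G (E^-1 p)), where G applies g to the
   coefficients: the homogenization of g by powers of t. *)
Definition homogenization (g : {rmorphism A -> A}) (p q : {poly A}) :=
  exists n u, 'X^n * p = E u /\ 'X^n * q = E (map_poly g u).

(** Over a common power of t the two numerators agree, because [E] is injective; the power of t then
    cancels. *)
Lemma homogenization_fun g p q q' :
  homogenization g p q -> homogenization g p q' -> q = q'.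
Proof.
move=> [n [u [pE qE]]] [m [u' [pE' qE']]].
have uE : 'X^m * u = 'X^n * u'.
  apply: E_inj; rewrite !rmorphM !EXn -pE -pE' !mulrA -!exprD.
  by rewrite addnC.
apply: (@mulXnI (m + n)).
rewrite [in RHS]addnC !exprD -!mulrA qE qE' -(EXn m) -(EXn n) -!rmorphM.
by rewrite -!map_poly_mulXn uE.
Qed.

Lemma homogenizationB g p q p' q' :
  homogenization g p q -> homogenization g p' q' ->
  homogenization g (p - p') (q - q').
Proof.
move=> [n [u [pE qE]]] [m [u' [pE' qE']]].
exists (n + m)%N, ('X^m * u - 'X^n * u'); split.
  by rewrite !rmorphB !rmorphM !EXn mulrBr -pE -pE' !mulrA -!exprD (addnC m).
rewrite !rmorphB /= !map_poly_mulXn !rmorphM !EXn mulrBr -qE -qE' !mulrA -!exprD.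
by rewrite (addnC m).
Qed.

Lemma homogenizationM g p q p' q' :
  homogenization g p q -> homogenization g p' q' ->
  homogenization g (p * p') (q * q').
Proof.
move=> [n [u [pE qE]]] [m [u' [pE' qE']]].
have XM (a b : {poly A}) : 'X^(n + m) * (a * b) = 'X^n * a * ('X^m * b).
  by rewrite exprD -!mulrA; congr (_ * _); rewrite !mulrA commr_polyXn.
exists (n + m)%N, (u * u').
by rewrite !rmorphM -pE -qE -pE' -qE'.
Qed.

Lemma homogenization1 g : homogenization g 1 1.
Proof. by exists 0, 1; rewrite !rmorph1 mulr1. Qed.

Lemma homogenizationX g : homogenization g 'X 'X.
Proof. by exists 0, 'X; rewrite map_polyX !EX mul1r. Qed.

Lemma homogenizationD g p q p' q' :
  homogenization g p q -> homogenization g p' q' ->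
  homogenization g (p + p') (q + q').
Proof.
move=> hp hp'; rewrite -[p']opprK -[q']opprK; apply: homogenizationB => //.
rewrite -[- p']add0r -[- q']add0r -{1}(subrr p') -{1}(subrr q').
by do 2![apply: homogenizationB => //].
Qed.

Lemma homogenization_inv (g g' : {rmorphism A -> A}) p q :
  cancel g g' -> homogenization g p q -> homogenization g' q p.
Proof.
move=> gK [n [u [pE qE]]]; exists n, (map_poly g u); split=> //.
by rewrite pE -map_poly_comp (eq_map_poly gK) map_poly_id.
Qed.

(** Divisibility of [e (g v)] by t^i says that [g v] has no component of degree below [i]. *)
Definition filtered (g : A -> A) :=
  forall i v, gr i v -> exists q, e (g v) = 'X^i * q.

(** For v in A_i the value is t^(-i) e(g v), a polynomial since [g] is filtered. Homogeneous
    elements and t generate A[t]. *)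
Lemma homogenization_total (g : {rmorphism A -> A}) :
  filtered g -> forall p, exists q, homogenization g p q.
Proof.
move=> gfilt.
have homog i v : gr i v -> exists q, homogenization g v%:P q.
  move=> iv; have [q qE] := gfilt i v iv; exists q, i, v%:P.
  by rewrite map_polyC !EC -qE (rees_homogeneous iv).
have h0 : homogenization g 0 0 by rewrite -(subrr 1); apply: homogenizationB; apply: homogenization1.
have D p p' : (exists q, homogenization g p q) ->
    (exists q, homogenization g p' q) -> exists q, homogenization g (p + p') q.
  by move=> [q hq] [q' hq']; exists (q + q'); apply: homogenizationD.
have const a : exists q, homogenization g a%:P q.
  rewrite [a]sum_homogeneous rmorph_sum; elim/big_ind: _ => [|//|i _].
    by exists 0.
  exact: homog (e_hom a i).
elim/poly_ind => [|p a [q IHp]]; first by exists 0.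
apply: D => //; exists (q * 'X); apply: homogenizationM => //.
exact: homogenizationX.
Qed.

Lemma rees_unipotent (g : A -> A) i v : unipotent gr g -> gr i v ->
  exists q, e (g v) = 'X^i * q /\ q`_0 = v.
Proof.
move=> guni iv; have [n [w [wgr gvE]]] := guni i v iv.
exists (v%:P + \sum_(i.+1 <= j < n) 'X^(j - i) * (w j)%:P); split; last first.
  rewrite coefD coefC coef_sum big_nat_cond big1 ?addr0 // => j /andP[/andP[ij _] _].
  by rewrite coefXnM subn_gt0 ij.
rewrite -[g v](subrK v) gvE addrC rmorphD rmorph_sum mulrDr mulr_sumr.
rewrite (rees_homogeneous iv); congr (_ + _); apply: eq_big_nat => j /andP[ij _].
by rewrite (rees_homogeneous (wgr j)) mulrA -exprD subnKC // ltnW.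
Qed.

Lemma unipotent_filtered g : unipotent gr g -> filtered g.
Proof. by move=> guni i v /(rees_unipotent guni)[q [qE _]]; exists q. Qed.

(** A unipotent map keeps the lowest component: if that of [u] had degree below [i], it would
    survive in [g u = v], which lies in A_i. *)
Lemma unipotent_inv_filtered (g : {rmorphism A -> A}) (g' : A -> A) :
  unipotent gr g -> cancel g' g -> filtered g'.
Proof.
move=> guni g'K i v iv; set u := g' v.
have /choice[q qE] l := rees_unipotent guni (e_hom u l).
have low j : (j < i)%N -> (e u)`_j = 0.
  elim/ltn_ind: j => j IHj ji.
  have [/(nth_default 0)//|ju] := leqP (size (e u)) j.
  have := congr1 (fun p : {poly A} => p`_j) (rees_homogeneous iv).
  rewrite coefXnM ji -(g'K v) -/u {1}[u]sum_homogeneous !rmorph_sum coef_sum.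
  (* Only the component of [u] of degree [j] contributes in degree [j]: higher ones start later,
     lower ones vanish by induction. *)
  rewrite (bigD1 (Ordinal ju)) //= (proj1 (qE j)) coefXnM ltnn subnn.
  rewrite (proj2 (qE j)) big1 ?addr0 // => l /eqP lj.
  have [jl|lj'] := ltnP j l; first by rewrite (proj1 (qE l)) coefXnM jl.
  have {lj'}lj : (l < j)%N.
    by rewrite ltn_neqAle lj' andbT; apply/eqP => h; apply/lj/val_inj.
  by rewrite (IHj l lj (ltn_trans lj ji)) !rmorph0 coef0.
exists (drop_poly i (e u)); apply/polyP => j; rewrite coefXnM coef_drop_poly.
by case: ltnP => [/low|/subnK ->].
Qed.

Lemma unipotent_eq_id (g : {rmorphism A -> A}) :
  (forall phi : {rmorphism {poly A} -> {poly A}}, bijective phi ->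
     forall a, (size (phi a%:P) <= 1)%N) ->
  bijective g -> unipotent gr g -> g =1 id.
Proof.
move=> const [g' gK g'K] guni.
pose m1 := GRing.isZmodMorphism.Build _ _ g' (can2_zmod_morphism gK g'K).
pose m2 := GRing.isMonoidMorphism.Build _ _ g' (can2_monoid_morphism gK g'K).
pose h : {rmorphism A -> A} := HB.pack g' m1 m2.
(* The homogenizations of [g] and of its inverse are mutually inverse; uniqueness of values yields
   this and the morphism laws. *)
have /choice[phi phiP] := homogenization_total (unipotent_filtered guni).
have h_filt : filtered h by exact: (unipotent_inv_filtered guni g'K).
have /choice[psi psiP] := homogenization_total h_filt.
have phi_zmod : zmod_morphism phi.
  move=> p q; apply: (homogenization_fun (phiP _)).
  exact: homogenizationB.
have phi_monoid : monoid_morphism phi.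
  split=> [|p q]; apply: (homogenization_fun (phiP _)).
    exact: homogenization1.
  exact: homogenizationM.
pose f1 := GRing.isZmodMorphism.Build _ _ phi phi_zmod.
pose f2 := GRing.isMonoidMorphism.Build _ _ phi phi_monoid.
pose f : {rmorphism {poly A} -> {poly A}} := HB.pack phi f1 f2.
have f_bij : bijective f.
  exists psi => p.
    apply: (homogenization_fun (psiP _)).
    exact: (@homogenization_inv g h _ _ gK (phiP p)).
  apply: (homogenization_fun (phiP _)).
  exact: (@homogenization_inv h g _ _ g'K (psiP p)).
have g_homog i v : gr i v -> g v = v.
  move=> iv; have [q [qE q0]] := rees_unipotent guni iv.
  have fv : phi v%:P = q.
    apply: (homogenization_fun (phiP _)); exists i, v%:P.
    by rewrite map_polyC !EC -qE (rees_homogeneous iv).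
  (* [q] is constant, hence equal to its constant term v, so e(g v) = t^i v = e(v). *)
  have := const f f_bij v; rewrite /= fv => /size1_polyC qC.
  by rewrite -[LHS]e_eval qE qC q0 -(rees_homogeneous iv).
move=> a; rewrite {1}[a]sum_homogeneous rmorph_sum [RHS]sum_homogeneous.
by apply: eq_bigr => i _; apply: g_homog (e_hom a i).
Qed.

End Rees.
End Graded.

Theorem theorem0p5 (R : realType) (k : fieldType) (A : algType k)
    (gr : nat -> set A) (r : nat) (z : 'I_r -> A)
    (char0 : [pchar k] =i pred0)
    (Agraded : connected_graded gr)
    (Adomain : GRing.integral_domain_axiom A)
    (Agk : (GKdim A R < +oo)%E)
    (Afree : center_basis z)
    (AD : discriminant_divisor_subalg z = [set: A]) :
  cancellative A /\ Aut_uni gr = [set idfun].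
Proof.
(* The image of the discriminant is constant, so the whole divisor subalgebra, here all of A, has
   constant image. *)
have const (B : algType k) (phi : {rmorphism {poly A} -> {poly B}}) :
    GRing.integral_domain_axiom B -> bijective phi ->
    forall a, (size (phi a%:P) <= 1)%N.
  move=> Bdom phi_bij a.
  have aD : discriminant_divisor_subalg z a by rewrite AD.
  apply: (constant_image_divisor_subalg Bdom (bij_inj phi_bij) _ aD).
  by move=> _ ->; apply: size_phi_discriminant.
split; first exact: cancellative_of_constant_images.
apply/seteqP; split=> [_ [h [h_bij h_uni ->]]|_ ->] /=.
  have [e eP] := rees_embedding Agraded.
  have [E [EC EX]] := extend_to_polyX e.
  apply/funext => a.
  apply: (unipotent_eq_id Agraded (fun a => proj1 (eP a))
    (fun a => proj2 (eP a)) EC EX _ h_bij h_uni) => phi phi_bij.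
  exact: const.
exists idfun; split=> [|i v _|//]; first by exists idfun.
(* For the identity the difference is 0, written as an empty sum. *)
exists 0, (fun=> 0); split=> [j|]; first exact: graded0.
by rewrite subrr big_geq.
Qed.
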